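(* Consider the noise-free plant, reference model, offline data, online sampling times $0=t_0<t_1<\dots<t_M<t_{M+1}=\infty$ and signals $\mathcal{U}(t),\mathcal{D}(t)$ described in the context. Let $\Gamma\in\mathbb{R}^{2n\times2n}$ be symmetric positive definite, and suppose that online (for $t\ge0$) the plant is driven by the input $$u(t)=\mathcal{U}(t)\Psi(t)\begin{bmatrix}x(t)\\ r(t)\end{bmatrix},\qquad\dot\Psi(t)=-\Gamma\left(\mathcal{D}(t)\Psi(t)-R_{\mathrm m}\right),$$ with $\Psi(t)\in\mathbb{R}^{2n\times(n+p)}$. If $\operatorname{im}R_{\mathrm m}\subseteq\operatorname{im}\mathcal{D}(t_M)$, then the control gains $\begin{bmatrix}\hat K(t)&\hat L(t)\end{bmatrix}:=\mathcal{U}(t)\Psi(t)$, with $\hat K(t)\in\mathbb{R}^{m\times n}$ and $\hat L(t)\in\mathbb{R}^{m\times p}$, satisfy $$\lim_{t\to\infty}\begin{bmatrix}A_{\mathrm m}-A_{\mathrm s}-B_{\mathrm s}\hat K(t)&B_{\mathrm m}-B_{\mathrm s}\hat L(t)\end{bmatrix}=0 .$$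
   Context: Noise-free plant ($q=0$): $\dot x(t)=A_{\mathrm s}x(t)+B_{\mathrm s}u(t)$ with $x\in\mathbb{R}^n$, $u\in\mathbb{R}^m$, $A_{\mathrm s}\in\mathbb{R}^{n\times n}$, $B_{\mathrm s}\in\mathbb{R}^{n\times m}$. Reference model: $\dot x_{\mathrm m}(t)=A_{\mathrm m}x_{\mathrm m}(t)+B_{\mathrm m}r(t)$ with $x_{\mathrm m}\in\mathbb{R}^n$, reference input $r\in\mathbb{R}^p$, $m\ge p$, $A_{\mathrm m}\in\mathbb{R}^{n\times n}$ Hurwitz, $B_{\mathrm m}\in\mathbb{R}^{n\times p}$, and $(A_{\mathrm m},B_{\mathrm m})$ controllable. Put $R_{\mathrm m}=\begin{bmatrix}I&0\\ A_{\mathrm m}&B_{\mathrm m}\end{bmatrix}\in\mathbb{R}^{2n\times(n+p)}$. Filters: fix $\rho>0$. For a plant trajectory $(u,x)$ starting at time $0$, define $\dot x^{\mathrm f}=-\rho x^{\mathrm f}+x$, $\dot u^{\mathrm f}=-\rho u^{\mathrm f}+u$ with zero initial values, and $x^{\mathrm{df}}(t)=x(t)-e^{-\rho t}x(0)-\rho x^{\mathrm f}(t)$. Offline data: from a plant trajectory on $[0,\mathcal{T}]$ and times $0<\tau_1<\dots<\tau_N\le\mathcal{T}$, form $X^{\mathrm D}=[x^{\mathrm{df}}(\tau_1)\cdots x^{\mathrm{df}}(\tau_N)]$, $X=[x^{\mathrm f}(\tau_1)\cdots x^{\mathrm f}(\tau_N)]$, $U=[u^{\mathrm f}(\tau_1)\cdots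 u^{\mathrm f}(\tau_N)]$. Piecewise constant signals ($M\ge1$ an integer; online filtered signals come from the closed-loop trajectory on $[0,\infty)$, with its own clock and filters): for $t\in[0,t_1)$, $\mathcal{U}(t)=\frac1N U\begin{bmatrix}X\\ X^{\mathrm D}\end{bmatrix}^\top$ and $\mathcal{D}(t)=\frac1N\begin{bmatrix}X\\ X^{\mathrm D}\end{bmatrix}\begin{bmatrix}X\\ X^{\mathrm D}\end{bmatrix}^\top$; for $t\in[t_j,t_{j+1})$, $j\in\{1,\dots,M\}$, $$\mathcal{U}(t)=\tfrac{N+j-1}{N+j}\mathcal{U}(t_{j-1})+\tfrac1{N+j}u^{\mathrm f}(t_j)\begin{bmatrix}x^{\mathrm f}(t_j)\\ x^{\mathrm{df}}(t_j)\end{bmatrix}^\top,\qquad \mathcal{D}(t)=\tfrac{N+j-1}{N+j}\mathcal{D}(t_{j-1})+\tfrac1{N+j}\begin{bmatrix}x^{\mathrm f}(t_j)\\ x^{\mathrm{df}}(t_j)\end{bmatrix}\begin{bmatrix}x^{\mathrm f}(t_j)\\ x^{\mathrm{df}}(t_j)\end{bmatrix}^\top.$$ *)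

(* Defs.v *)
(* MathComp + MathComp-Analysis (over an abstract realType); the complex field
   R[i] of mathcomp-real-closed is only used to state the Hurwitz property. *)
From HB Require Import structures.
From mathcomp Require Import all_boot all_order all_algebra.
From mathcomp Require Import all_classical all_reals all_analysis.
From mathcomp Require Import complex.

Set Implicit Arguments.
Unset Strict Implicit.
Unset Printing Implicit Defensive.
Import Order.TTheory GRing.Theory Num.Theory.
Import numFieldNormedType.Exports.
Local Open Scope classical_set_scope.
Local Open Scope ring_scope.

(* J stands for an interval starting at 0: [0, T] or [0, +oo[. *)
Definition loc_integrable (R : realType) (a b : nat) (J : set R)
    (f : R -> 'M[R]_(a, b)) : Prop :=
  forall t, J t -> forall i k,
    (@lebesgue_measure R).-integrable `[0, t] (fun s => (f s i k)%:E).

(* z is a Caratheodory solution on J of z'(t) = f(t): signals such as a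
   feedback with switching gains are discontinuous, so z is differentiable
   only almost everywhere. The right-hand side may itself depend on z. *)
Definition ode_solution (R : realType) (a b : nat) (J : set R)
    (z f : R -> 'M[R]_(a, b)) : Prop :=
  loc_integrable J f /\
  forall t, J t ->
    z t = z 0 + \matrix_(i, k) \int[@lebesgue_measure R]_(s in `[0, t]) f s i k.

Definition trajectory (R : realType) (n m : nat)
    (A : 'M[R]_n) (B : 'M[R]_(n, m)) (J : set R)
    (u : R -> 'cV[R]_m) (x : R -> 'cV[R]_n) : Prop :=
  loc_integrable J u /\ ode_solution J x (fun t => A *m x t + B *m u t).

Definition hurwitz (R : realType) (n : nat) (A : 'M[R]_n) : Prop :=
  forall z : complex R,
    eigenvalue (map_mx (real_complex R) A) z -> complex.Re z < 0.

Definition controllable (R : realType) (n m : nat)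
    (A : 'M[R]_n) (B : 'M[R]_(n, m)) : Prop :=
  forall x0 x1 : 'cV[R]_n, exists T : R, 0 < T /\
    exists (u : R -> 'cV[R]_m) (x : R -> 'cV[R]_n),
      [/\ trajectory A B `[0, T] u x, x 0 = x0 & x T = x1].

Definition sym_posdef (R : realType) (n : nat) (G : 'M[R]_n) : Prop :=
  G^T = G /\ forall v : 'cV[R]_n, v != 0 -> 0 < (v^T *m G *m v) 0 0.

Definition filtered (R : realType) (a : nat) (rho : R) (J : set R)
    (w wf : R -> 'cV[R]_a) : Prop :=
  wf 0 = 0 /\ ode_solution J wf (fun t => - rho *: wf t + w t).

Definition dfiltered (R : realType) (n : nat) (rho : R)
    (x xf : R -> 'cV[R]_n) (t : R) : 'cV[R]_n :=
  x t - expR (- rho * t) *: x 0 - rho *: xf t.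

Definition sample_mx (R : realType) (a N : nat) (f : R -> 'cV[R]_a)
    (tau : 'I_N -> R) : 'M[R]_(a, N) :=
  \matrix_(i, k) f (tau k) i 0.

Definition ref_mx (R : realType) (n p : nat) (A : 'M[R]_n) (B : 'M[R]_(n, p)) :
    'M[R]_(n + n, n + p) :=
  block_mx 1%:M 0 A B.

(* [t_j, t_{j+1}) for j <= M, with t_{M+1} = +oo; values of ts beyond M are
   irrelevant. *)
Definition cell (R : realType) (M : nat) (ts : nat -> R) (j : nat) : set R :=
  [set s | ts j <= s /\ ((j < M)%N -> s < ts j.+1)].

(* S is, on [0, +oo), the piecewise constant running average which starts from
   S0 (an average of N terms) and incorporates the sample g (ts j) at time
   ts j. *)
Definition running_average (R : realType) (a b N M : nat) (ts : nat -> R)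
    (S0 : 'M[R]_(a, b)) (g S : R -> 'M[R]_(a, b)) : Prop :=
  (forall s, cell M ts 0 s -> S s = S0) /\
  (forall j, (1 <= j <= M)%N -> forall s, cell M ts j s ->
     S s = ((N + j - 1)%:R / (N + j)%:R) *: S (ts j.-1)
           + (N + j)%:R^-1 *: g (ts j)).

(* Main.v *)
Require Import Defs.
From HB Require Import structures.
From mathcomp Require Import all_boot all_order all_algebra.
From mathcomp Require Import all_classical all_reals all_analysis.
From mathcomp Require Import ring lra.

Set Implicit Arguments.
Unset Strict Implicit.
Unset Printing Implicit Defensive.
Import Order.TTheory GRing.Theory Num.Theory.
Import numFieldNormedType.Exports.
Local Open Scope classical_set_scope.
Local Open Scope ring_scope.

(** Write Z = [xf; xdf] for the regressor and H = [-As I].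

    The filtered signals satisfy the plant equation without any derivative:
    xdf = As xf + Bs uf, that is Bs uf = H Z.  Indeed y = x - rho xf - As xf -
    Bs uf solves y' = - rho y with y(0) = x(0) (lemma dfiltered_linear).  This
    linear relation passes from samples to their averages, so at all times
    Bs Us = H Ds (lemma running_average_ind2).  Since H R_m = [Am - As, Bm],
    the matching error is H (R_m - Ds Psi): it suffices that the residual
    Ds Psi - R_m tends to 0.

    After the last sampling time Ds is a constant positive semidefinite matrix
    D, and by the range hypothesis R_m = D W for some W.  Each column z of
    Psi - W follows the gradient flow z' = - Gamma D z.  Along it V = z^T D z
    has derivative - 2 (D z)^T Gamma (D z) <= - 2 c V with c > 0, although D may
    be singular: as D = D D^+ D for a generalized inverse D^+, V is a quadratic
    form in D z (psd_dissipation).  So V decays exponentially, and the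
    Cauchy-Schwarz inequality for D gives (D z)_i ^ 2 <= D_ii V, hence
    D z tends to 0 (gradient_flow_residual_cvg0).

    Solutions are only known in integral form.  A right-hand side which is
    continuous at an interior point makes the solution differentiable there by
    the fundamental theorem of calculus (ode_solution_is_derive); this applies
    to y, and to Psi after the last sampling time. *)

(** * Solutions of differential equations in integral form *)

Section CaratheodorySolutions.
Context {R : realType}.
Notation mu := (@lebesgue_measure R).
Implicit Type J : set R.

Lemma ode_solutionD a b J (z1 z2 f1 f2 : R -> 'M[R]_(a, b)) :
  ode_solution J z1 f1 -> ode_solution J z2 f2 ->
  ode_solution J (fun t => z1 t + z2 t) (fun t => f1 t + f2 t).
Proof.
move=> [i1 e1] [i2 e2]; split=> t Jt.
  move=> i k; have := integrableD _ (i1 _ Jt i k) (i2 _ Jt i k).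
  move=> /(_ (measurable_itv _)).
  by apply: eq_integrable => // s _ /=; rewrite mxE EFinD.
rewrite (e1 _ Jt) (e2 _ Jt) addrACA; congr (_ + _); apply/matrixP => i k.
rewrite !mxE -RintegralD//; last 2 first.
- exact: i1.
- exact: i2.
by apply: eq_Rintegral => s _; rewrite mxE.
Qed.

Lemma ode_solution_mulmx a b c J (A : 'M[R]_(c, a)) (z f : R -> 'M[R]_(a, b)) :
  ode_solution J z f -> ode_solution J (fun t => A *m z t) (fun t => A *m f t).
Proof.
move=> [iz ez].
have intZ t i j k : J t ->
    mu.-integrable `[0, t] (fun s => (A i j * f s j k)%:E).
  move=> Jt; have := integrableZl _ (A i j) (iz _ Jt j k).
  move=> /(_ (measurable_itv _)).
  by apply: eq_integrable => // s _ /=; rewrite EFinM.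
split=> t Jt.
  move=> i k.
  have := @integrable_sum _ _ R mu `[0, t] (measurable_itv _) _
    (index_enum 'I_a) xpredT (fun j s => (A i j * f s j k)%:E)
    (fun j _ => intZ t i j k Jt).
  by apply: eq_integrable => // s _; rewrite sumEFin mxE.
rewrite (ez _ Jt) mulmxDr; congr (_ + _); apply/matrixP => i k.
rewrite !mxE.
transitivity (\sum_j \int[mu]_(s in `[0, t]) (A i j * f s j k)).
  by apply: eq_bigr => j _; rewrite mxE RintegralZl//; exact: iz.
rewrite /Rintegral sum_fine; last first.
  move=> j _; apply: integrable_fin_num => //; exact: intZ.
rewrite -integral_sum//=; last by move=> j; exact: intZ.
by congr fine; apply: eq_integral => s _ /=; rewrite mxE sumEFin.
Qed.

Lemma ode_solution_continuous a b J (z f : R -> 'M[R]_(a, b)) (t : R) i k :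
  ode_solution J z f -> 0 <= t -> `[0, t] `<=` J ->
  {within `[0, t], continuous (fun s => z s i k)}.
Proof.
move=> [iz ez] t0 sJ.
have Jt : J t by apply: sJ; rewrite /= in_itv /= t0 lexx.
have := parameterized_integral_continuous t0 (iz _ Jt i k).
move=> cF.
have cG : {within `[0, t], continuous (fun s => z 0 i k +
    parameterized_integral mu 0 s (fun s => f s i k))}.
  by move=> s; apply: cvgD; [exact: cvg_cst|exact: cF].
apply: subspace_eq_continuous cG => s; rewrite inE => st.
by rewrite /from_subspace /= (ez s (sJ _ st)) !mxE.
Qed.

(** The bound t only has to exceed s: the fundamental theorem of calculus needs
    the right-hand side to be integrable a little beyond s. *)
Lemma ode_solution_is_derive a b J (z f : R -> 'M[R]_(a, b)) (s t : R) i k :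
  ode_solution J z f -> `[0, t] `<=` J -> 0 < s < t ->
  {for s, continuous (fun s => f s i k)} ->
  is_derive s 1 (fun s => z s i k) (f s i k).
Proof.
move=> [iz ez] sJ /andP[s0 st] cf.
have Jt : J t by apply: sJ; rewrite /= in_itv /= lexx (ltW (lt_trans s0 st)).
have [dF F'] := continuous_FTC1_closed st (iz _ Jt i k) s0 cf.
have dG : is_derive s 1 (fun y => z 0 i k +
    \int[mu]_(r in `[0, y]) f r i k) (f s i k).
  apply: is_derive_eq (add0r _).
  by apply: is_deriveD; rewrite -F' derive1E; exact: derivableP.
apply: near_eq_is_derive dG.
near=> y; rewrite (ez y) ?mxE//.
apply: sJ; rewrite /= in_itv /=; apply/andP; split; apply/ltW; near: y.
  exact: lt_nbhsr.
exact: lt_nbhsl.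
Unshelve. all: by end_near. Qed.

Lemma is_derive_expRM (c s : R) :
  is_derive s 1 (fun r => expR (c * r)) (c * expR (c * s)).
Proof.
have dl : is_derive s 1 (fun r => c * r) c.
  have := is_deriveZ c (is_derive_id s (1 : R)).
  by rewrite /GRing.scale/= mulr1.
by apply: is_derive_eq; rewrite mulrC.
Qed.

(** The equation makes z continuous, hence its right-hand side continuous,
    hence z differentiable inside the interval; then exp (- c s) z(s) is
    constant. *)
Lemma ode_solution_expR a b (c t : R) (z : R -> 'M[R]_(a, b)) :
  ode_solution `[0, t] z (fun s => c *: z s) -> 0 <= t ->
  z t = expR (c * t) *: z 0.
Proof.
move=> sz; rewrite le_eqVlt => /predU1P[<-|t0].
  by rewrite mulr0 expR0 scale1r.
apply/matrixP => i k; rewrite !mxE.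
have cz := ode_solution_continuous (i := i) (k := k) sz (ltW t0) (@subset_refl _ _).
have /(continuous_within_itvP _ t0)[cz0 _ _] := cz.
have dz s : s \in `]0, t[%R -> is_derive s 1 (fun s => z s i k) (c * z s i k).
  move=> st; have := ode_solution_is_derive (i := i) (k := k) sz (@subset_refl _ _).
  move=> /(_ s); rewrite mxE; apply; first by move: st; rewrite in_itv.
  have -> : (fun s => (c *: z s) i k) = (fun s => c * z s i k).
    by apply/funext => r; rewrite mxE.
  by apply: cvgM; [exact: cvg_cst|exact: cz0].
pose g s := expR (- c * s) * z s i k.
have de := is_derive_expRM (- c).
have dg s : s \in `]0, t[%R -> is_derive s 1 g 0.
  move=> /dz ?; apply: is_derive_eq; rewrite /GRing.scale/=; ring.
have cg : {within `[0, t], continuous g}.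
  move=> s; apply: cvgM; last exact: cz.
  apply: continuous_subspaceT => r; apply: differentiable_continuous.
  by apply/derivable1_diffP; exact: ex_derive.
(* the mean value theorem, applied to a function with zero derivative *)
have [s _] := @MVT R g (fun=> 0) 0 t t0 dg cg.
rewrite mul0r /g mulr0 expR0 mul1r => /eqP; rewrite subr_eq0 => /eqP <-.
by rewrite mulrA -expRD mulNr subrr expR0 mul1r.
Qed.
End CaratheodorySolutions.

(** * The identity satisfied by the filtered signals *)

Section FilterIdentity.
Context {R : realType}.

(** The combination x - (rho + A) xf - B uf solves y' = - rho y, because the
    right-hand sides of the filters reproduce the plant equation; it therefore
    equals exp (- rho t) x(0), which is the term subtracted in the definition
    of the derivative filter. *)
Lemma dfiltered_linear n m (A : 'M[R]_n) (B : 'M[R]_(n, m)) (rho : R) (J : set R)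
    (u uf : R -> 'cV[R]_m) (x xf : R -> 'cV[R]_n) (t : R) :
  trajectory A B J u x -> filtered rho J u uf -> filtered rho J x xf ->
  0 <= t -> `[0, t] `<=` J ->
  dfiltered rho x xf t = A *m xf t + B *m uf t.
Proof.
move=> [_ sx] [uf0 suf] [xf0 sxf] t0 sJ.
pose y s := x s + ((- (rho%:M + A)) *m xf s + (- B) *m uf s).
have := ode_solutionD sx (ode_solutionD (ode_solution_mulmx (- (rho%:M + A)) sxf)
  (ode_solution_mulmx (- B) suf)).
rewrite -/y (_ : (fun s => _) = fun s => (- rho) *: y s); last first.
  apply/funext => s; rewrite /y !mulNmx !mulmxDl !mulmxDr !mul_scalar_mx -!scalemxAr.
  by apply/matrixP => i k; rewrite !mxE; ring.
move=> [iy ey].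
have {iy ey} sy : ode_solution `[0, t] y (fun s => (- rho) *: y s).
  by split=> s /sJ; [exact: iy|exact: ey].
have := ode_solution_expR sy t0.
rewrite {2}/y uf0 xf0 !mulmx0 !addr0 /dfiltered => <-.
rewrite /y !mulNmx mulmxDl mul_scalar_mx.
by apply/matrixP => i k; rewrite !mxE; ring.
Qed.
End FilterIdentity.

Section SampledData.
Context {R : realType}.

Lemma sample_mx_dfiltered n m N (A : 'M[R]_n) (B : 'M[R]_(n, m)) (rho T : R)
    (u uf : R -> 'cV[R]_m) (x xf : R -> 'cV[R]_n) (tau : 'I_N -> R) :
  trajectory A B `[0, T] u x ->
  filtered rho `[0, T] u uf -> filtered rho `[0, T] x xf ->
  (forall i, 0 < tau i <= T) ->
  sample_mx (dfiltered rho x xf) tau =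
  A *m sample_mx xf tau + B *m sample_mx uf tau.
Proof.
move=> hx huf hxf htau; apply/matrixP => i k.
have /andP[t0 tT] := htau k.
rewrite mxE (dfiltered_linear hx huf hxf (ltW t0)); last first.
  by move=> s; rewrite /= !in_itv/= => /andP[-> st]; exact: le_trans tT.
by rewrite !mxE; congr (_ + _); apply: eq_bigr => j _; rewrite [in RHS]mxE.
Qed.

End SampledData.

(** * Quadratic forms of semidefinite matrices *)

Section SemidefiniteForms.
Context {R : realFieldType}.

Definition qform n (P : 'M[R]_n) (v : 'cV[R]_n) : R := (v^T *m P *m v) 0 0.

Definition psd n (P : 'M[R]_n) := P^T = P /\ forall v, 0 <= qform P v.

(** The form may be degenerate, so two discriminant vectors are tested: b v - a w
    settles the case a > 0, and (c + 1) v - b w forces b = 0 when a = 0. *)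
Lemma psd_cauchy_schwarz n (P : 'M[R]_n) (v w : 'cV[R]_n) : psd P ->
  ((v^T *m P *m w) 0 0) ^+ 2 <= qform P v * qform P w.
Proof.
move=> [sP nP].
set a := qform P v; set b := (v^T *m P *m w) 0 0; set c := qform P w.
have E (s r : R) : qform P (s *: v + r *: w) =
    s ^+ 2 * a + 2 * s * r * b + r ^+ 2 * c.
  have bs : (w^T *m P *m v) 0 0 = b.
    by rewrite /b -[in RHS]sP -{2}(trmxK w) -trmx_mul -mulmxA -trmx_mul [RHS]mxE
         ?mulmxA.
  rewrite /qform (_ : (s *: v + r *: w)^T = s *: v^T + r *: w^T); last first.
    by apply/matrixP => i j; rewrite !mxE.
  rewrite !mulmxDl !mulmxDr -!scalemxAl -!scalemxAr.
  move: bs; rewrite /a /b /c /qform.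
  move: (v^T *m P *m v) (v^T *m P *m w) (w^T *m P *m v) (w^T *m P *m w).
  by move=> vv vw wv ww wvE; rewrite !mxE wvE; ring.
have a0 : 0 <= a by exact: nP.
have c0 : 0 <= c by exact: nP.
have H1 := nP (b *: v + (- a) *: w).
have H2 := nP ((c + 1) *: v + (- b) *: w).
rewrite E in H1; rewrite E in H2.
have [a1|a1] := ltP 0 a.
  have : 0 <= a * (a * c - b ^+ 2) by apply: le_trans H1 _; nra.
  by rewrite pmulr_rge0// subr_ge0.
have {a1 a0}a0 : a = 0 by apply/eqP; rewrite eq_le a1 a0.
rewrite a0 mul0r in H2 *.
nra.
Qed.

(** Cauchy-Schwarz against a basis vector: the image P v is controlled by the
    energy of v, even when P is singular. *)
Lemma qform_delta_mul n (P : 'M[R]_n) (v : 'cV[R]_n) i :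
  psd P -> (P *m v) i 0 ^+ 2 <= P i i * qform P v.
Proof.
move=> pP; have := psd_cauchy_schwarz (delta_mx i 0) v pP.
rewrite {1}/qform trmx_delta -!rowE -row_mul -colE.
by rewrite [(row _ (_ *m _)) _ _]mxE [(col _ _) _ _]mxE [(row _ _) _ _]mxE.
Qed.

Lemma qformE n (P : 'M[R]_n) (v : 'cV[R]_n) :
  qform P v = \sum_i \sum_j v i 0 * P i j * v j 0.
Proof.
rewrite /qform -mulmxA !mxE; apply: eq_bigr => i _; rewrite !mxE mulr_sumr.
by apply: eq_bigr => j _; rewrite mulrA.
Qed.

Lemma qform_le_sumsq n (P : 'M[R]_n) :
  exists2 C : R, 0 <= C & forall v, qform P v <= C * \sum_i v i 0 ^+ 2.
Proof.
exists (\sum_i \sum_j `|P i j|).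
  by apply: sumr_ge0 => i _; apply: sumr_ge0 => j _.
move=> v; rewrite qformE mulr_suml; apply: ler_sum => i _.
rewrite mulr_suml; apply: ler_sum => j _.
set S := \sum_i _.
have S1 k : v k 0 ^+ 2 <= S.
  rewrite /S (bigD1 k)//= lerDl sumr_ge0// => l _; exact: sqr_ge0.
apply: le_trans (ler_norm _) _; rewrite !normrM mulrAC mulrC.
apply: ler_wpM2l => //.
have := S1 i; have := S1 j; rewrite -(real_normK (num_real (v i 0))).
rewrite -(real_normK (num_real (v j 0))).
by have := sqr_ge0 (`|v i 0| - `|v j 0|); nra.
Qed.

Lemma psd_gram n k (Z : 'M[R]_(n, k)) : psd (Z *m Z^T).
Proof.
split=> [|v]; first by rewrite trmx_mul trmxK.
rewrite /qform mulmxA -mulmxA -{1}(trmxK Z) -trmx_mul mxE.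
by apply: sumr_ge0 => i _; rewrite mxE -expr2 sqr_ge0.
Qed.

Lemma psdZ n (a : R) (P : 'M[R]_n) : 0 <= a -> psd P -> psd (a *: P).
Proof.
move=> a0 [sP pP]; split=> [|v]; first by rewrite linearZ/= sP.
by rewrite /qform -scalemxAr -scalemxAl mxE mulr_ge0//; exact: pP.
Qed.

Lemma psdD n (P Q : 'M[R]_n) : psd P -> psd Q -> psd (P + Q).
Proof.
move=> [sP pP] [sQ pQ]; split=> [|v]; first by rewrite linearD/= sP sQ.
by rewrite /qform mulmxDr mulmxDl mxE addr_ge0//; [exact: pP|exact: pQ].
Qed.

End SemidefiniteForms.

Section PositiveDefinite.
Context {R : realType}.

Lemma sym_posdef_psd n (G : 'M[R]_n) : sym_posdef G -> psd G.
Proof.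
move=> [sG pG]; split=> // v; have [->|/pG/ltW//] := eqVneq v 0.
by rewrite /qform mulmx0 mxE.
Qed.

Lemma sym_posdef_unitmx n (G : 'M[R]_n) : sym_posdef G -> G \in unitmx.
Proof.
move=> [_ pG]; rewrite -row_free_unit -kermx_eq0; apply/rowV0P => v.
move=> /sub_kermxP vG; apply/eqP; apply/negPn/negP => v0.
have /pG : v^T != 0 by rewrite -trmx0 (inj_eq trmx_inj).
by rewrite trmxK vG mul0mx mxE ltxx.
Qed.

(** Coercivity without compactness or eigenvalues: v_i = w_i^T G v with
    w_i = G^-1 e_i, so Cauchy-Schwarz for G bounds v_i ^ 2. *)
Lemma sumsq_le_qform n (G : 'M[R]_n) : sym_posdef G ->
  exists2 C : R, 0 <= C & forall v : 'cV[R]_n, \sum_i v i 0 ^+ 2 <= C * qform G v.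
Proof.
move=> dG; have pG := sym_posdef_psd dG.
pose w i : 'cV[R]_n := invmx G *m delta_mx i 0.
exists (\sum_i qform G (w i)).
  by apply: sumr_ge0 => i _; exact: pG.2.
move=> v; rewrite mulr_suml; apply: ler_sum => i _.
have := psd_cauchy_schwarz (w i) v pG; congr (_ ^+ 2 <= _).
rewrite /w trmx_mul trmx_inv pG.1 -[_ *m G]mulmxA mulVmx ?sym_posdef_unitmx//.
by rewrite mulmx1 trmx_delta -rowE mxE.
Qed.

(** The dissipation along the gradient flow dominates the energy although D may
    be singular: with a generalized inverse, z^T D z = (D z)^T D^+ (D z) depends
    on z through D z only, and on such vectors G is coercive. *)
Lemma psd_dissipation n (G D : 'M[R]_n) : sym_posdef G -> psd D ->
  exists2 c : R, 0 < c & forall z, c * qform D z <= qform G (D *m z).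
Proof.
move=> dG [sD pD].
have [C1 C10 H1] := qform_le_sumsq (pinvmx D).
have [C2 C20 H2] := sumsq_le_qform dG.
have C0 : 0 < C1 * C2 + 1 by rewrite ltr_wpDl// mulr_ge0.
exists (C1 * C2 + 1)^-1; first by rewrite invr_gt0.
move=> z; rewrite mulrC ler_pdivrMr//.
have -> : qform D z = qform (pinvmx D) (D *m z).
  rewrite /qform trmx_mul sD; congr (fun_of_matrix _ 0 0).
  by rewrite -[in LHS](mulmxKpV (submx_refl D)) !mulmxA.
have q0 : 0 <= qform G (D *m z) by exact: (sym_posdef_psd dG).2.
apply: le_trans (H1 _) _; apply: le_trans (ler_wpM2l C10 (H2 _)) _.
by rewrite mulrDr mulr1 mulrA [_ * (C1 * C2)]mulrC lerDl.
Qed.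

Lemma is_derive_qform n (P : 'M[R]_n) (z : R -> 'cV[R]_n) (dz : 'cV[R]_n) (t : R) :
  P^T = P -> (forall i, is_derive t 1 (fun s => z s i 0) (dz i 0)) ->
  is_derive t 1 (fun s => qform P (z s)) (2 * (dz^T *m P *m z t) 0 0).
Proof.
move=> sP hz.
have -> : (fun s => qform P (z s)) =
    \sum_(i < n) \sum_(j < n) (fun s => z s i 0 * (P i j * z s j 0)).
  apply/funext => s; rewrite fct_sumE qformE; apply: eq_bigr => i _.
  by rewrite fct_sumE; apply: eq_bigr => j _; rewrite mulrA.
apply: is_derive_eq.
rewrite /GRing.scale/=.
under eq_bigr do rewrite big_split/=.
rewrite big_split/= mulr_natl mulr2n.
have e : \sum_i \sum_j dz i 0 * P i j * z t j 0 = (dz^T *m P *m z t) 0 0.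
  rewrite -mulmxA !mxE; apply: eq_bigr => i _; rewrite !mxE mulr_sumr.
  by apply: eq_bigr => j _; rewrite mulrA.
congr (_ + _); rewrite -e; last first.
  by apply: eq_bigr => i _; apply: eq_bigr => j _; ring.
rewrite exchange_big; apply: eq_bigr => i _; apply: eq_bigr => j _.
by rewrite -[in LHS]sP mxE; ring.
Qed.

End PositiveDefinite.

(** * Convergence of the gradient flow *)

Section Limits.
Context {R : realType}.

Lemma cvg_mulmx_entry a b c (T : Type) (F : set_system T) (A : 'M[R]_(a, b))
    (f : T -> 'M[R]_(b, c)) (L : 'M[R]_(b, c)) : Filter F ->
  (forall j k, f t j k @[t --> F] --> L j k) ->
  forall i k, (A *m f t) i k @[t --> F] --> (A *m L) i k.
Proof.
move=> FF fL i k; rewrite mxE.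
rewrite [X in X @ _ --> _](_ : _ = fun t => \sum_j A i j * f t j k); last first.
  by apply/funext => t; rewrite mxE.
apply: (@cvg_big _ _ _ _ _ add_continuous) => // j _.
by apply: cvgM; [exact: cvg_cst|exact: fL].
Qed.

Lemma cvg_mx a b (T : Type) (F : set_system T) (f : T -> 'M[R]_(a, b))
    (L : 'M[R]_(a, b)) : Filter F ->
  (forall i j, f t i j @[t --> F] --> L i j) -> f t @[t --> F] --> L.
Proof.
move=> FF fL A [P LP PA].
have : \forall t \near F, forall i j, P i j (f t i j).
  by apply: filter_forall => i; apply: filter_forall => j; exact: (fL i j).
by apply: filterS => t Pt; exact: PA.
Qed.

Lemma cvg0_sqr_le (T : Type) (F : set_system T) (f g : T -> R) (C : R) :
  Filter F -> (\forall t \near F, f t ^+ 2 <= C * g t) ->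
  g t @[t --> F] --> 0 -> f t @[t --> F] --> 0.
Proof.
move=> FF fg g0; apply: norm_cvg0.
have sq0 : f t ^+ 2 @[t --> F] --> 0.
  apply: (@squeeze_cvgr _ _ _ _ (fun=> 0) (fun t => C * g t)).
  - by apply: filterS fg => t ->; rewrite sqr_ge0.
  - exact: cvg_cst.
  - by rewrite -(mulr0 C); apply: cvgM; [exact: cvg_cst|exact: g0].
have := cvg_comp _ _ sq0 (@sqrt_continuous R 0).
rewrite sqrtr0 (_ : _ \o _ = fun t => `|f t|)//.
by apply/funext => t; rewrite /= sqrtr_sqr.
Qed.

(** A differential form of Gronwall: exp (c t) V(t) is nonincreasing. *)
Lemma exp_decay_cvg0 (V dV : R -> R) (a c : R) : 0 < c ->
  (forall t, a < t -> is_derive t 1 V (dV t)) ->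
  (forall t, a < t -> dV t <= - (c * V t)) ->
  (forall t, a < t -> 0 <= V t) -> V t @[t --> +oo] --> 0.
Proof.
move=> c0 hV hdV V0.
pose g t := expR (c * t) * V t.
have dg t : a < t -> is_derive t 1 g (expR (c * t) * (c * V t + dV t)).
  move=> /hV ?; have de := is_derive_expRM c t.
  by apply: is_derive_eq; rewrite /GRing.scale/=; ring.
(* starting at a + 1 rather than a makes g continuous at the left end point *)
have a1 t : a + 1 <= t -> a < t by apply: lt_le_trans; rewrite ltrDl.
have gn t : a + 1 <= t -> g t <= g (a + 1).
  move=> at1; apply: (@ler0_derive1_nincry R g (a + 1)) => //.
  - by move=> s; rewrite in_itv/= andbT => /ltW/a1/dg ?; exact: ex_derive.
  - move=> s; rewrite in_itv/= andbT => /ltW/a1 as1.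
    have ds := dg _ as1; rewrite derive1E derive_val.
    by rewrite pmulr_rle0 ?expR_gt0// -lerBrDl sub0r hdV.
  - apply: derivable_within_continuous => s; rewrite in_itv/= andbT => /a1/dg ?.
    exact: ex_derive.
apply: (@squeeze_cvgr _ _ _ _ (fun=> 0) (fun t => g (a + 1) * expR (- (c * t)))).
- near=> t; have at1 : a + 1 <= t by near: t; apply: nbhs_pinfty_ge; exact: num_real.
  rewrite V0 ?a1//= expRN ler_pdivlMr ?expR_gt0// mulrC; exact: gn.
- exact: cvg_cst.
- rewrite -(mulr0 (g (a + 1))); apply: cvgM; first exact: cvg_cst.
  have h : c * t @[t --> +oo] --> +oo by apply: gt0_cvgMry => //; exact: cvg_id.
  exact: cvg_comp h (@cvgr_expR R).
Unshelve. all: by end_near. Qed.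
End Limits.

Section GradientFlow.
Context {R : realType}.

(** Lyapunov argument, column by column, with the energy z^T D z of
    z = Psi - W.  Psi itself need not converge to W: only the image under D
    of the error does. *)
Lemma gradient_flow_residual_cvg0 n q (G D : 'M[R]_n) (W : 'M[R]_(n, q))
    (Psi : R -> 'M[R]_(n, q)) (a : R) :
  sym_posdef G -> psd D ->
  (forall t, a < t -> forall i k, is_derive t 1 (fun s => Psi s i k)
     ((- (G *m (D *m Psi t - D *m W))) i k)) ->
  forall i k, (D *m Psi t - D *m W) i k @[t --> +oo] --> 0.
Proof.
move=> dG pD hPsi i k; have [sD D0] := pD.
have [c c0 hc] := psd_dissipation dG pD.
pose z t := col k (Psi t - W).
have Dz t : D *m z t = col k (D *m Psi t - D *m W).
  by rewrite -mulmxBr colE -mulmxA -colE.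
have dz t : a < t -> forall j,
    is_derive t 1 (fun s => z s j 0) ((- (G *m (D *m z t))) j 0).
  move=> at1 j; have dP := hPsi t at1 j k.
  have -> : (fun s => z s j 0) = (fun s => Psi s j k - W j k).
    by apply/funext => s; rewrite !mxE.
  apply: is_derive_eq; rewrite subr0 Dz !mxE; congr (- _).
  by apply: eq_bigr => l _; rewrite !mxE.
have dV t : a < t ->
    is_derive t 1 (fun s => qform D (z s)) (- (2 * qform G (D *m z t))).
  move=> /dz /(is_derive_qform sD) ?; apply: is_derive_eq.
  rewrite linearN/= !trmx_mul dG.1 sD !mulNmx mxE mulrN /qform.
  by rewrite trmx_mul sD !mulmxA.
have V0 : qform D (z t) @[t --> +oo] --> 0.
  apply: (@exp_decay_cvg0 R _ _ a (2 * c) _ dV); first by rewrite mulr_gt0.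
  - by move=> t _; rewrite lerN2 -mulrA ler_pM2l.
  - by move=> t _; exact: D0.
apply: (@cvg0_sqr_le _ _ _ _ _ (D i i) _ _ V0).
apply: nearW => t; have := qform_delta_mul (z t) i pD.
by rewrite Dz [(col _ _) _ _]mxE.
Qed.
End GradientFlow.

(** * Running averages of sampled data *)

Section RunningAverage.
Context {R : realType}.

Lemma sampling_times_ge0 M (ts : nat -> R) :
  ts 0%N = 0 -> (forall j, (j < M)%N -> ts j < ts j.+1) ->
  forall j, (j <= M)%N -> 0 <= ts j.
Proof.
move=> ts0 tsS; elim=> [|j IH jM]; first by rewrite ts0.
by apply: le_trans (ltW (tsS _ jM)); apply: IH; exact: ltnW.
Qed.

(** A binary invariant is needed because the input and regressor averages have to
    be compared at the same time: any relation which holds for the data and is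
    stable under nonnegative combinations holds for the averages. *)
Lemma running_average_ind2 a b a' b' N M (ts : nat -> R)
    (Q : 'M[R]_(a, b) -> 'M[R]_(a', b') -> Prop) S0 g S S0' g' S' :
  running_average N M ts S0 g S -> running_average N M ts S0' g' S' ->
  ts 0%N = 0 -> (forall j, (j < M)%N -> ts j < ts j.+1) ->
  Q S0 S0' -> (forall t, 0 <= t -> Q (g t) (g' t)) ->
  (forall al be A A' B B', 0 <= al -> 0 <= be -> Q A A' -> Q B B' ->
     Q (al *: A + be *: B) (al *: A' + be *: B')) ->
  forall t, 0 <= t -> Q (S t) (S' t).
Proof.
move=> [hS0 hS] [hS0' hS'] ts0 tsS Q0 Qg Qlin.
have ts_ge0 := sampling_times_ge0 ts0 tsS.
have Qcell j : (j <= M)%N -> forall t, cell M ts j t -> Q (S t) (S' t).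
  elim: j => [_ t ct|j IH jM t ct]; first by rewrite hS0// hS0'.
  rewrite (hS j.+1)// (hS' j.+1)//=; apply: Qlin.
  - by rewrite divr_ge0.
  - by rewrite invr_ge0.
  - by apply: IH; [exact: ltnW|split=> // _; exact: tsS].
  - by apply: Qg; exact: ts_ge0.
move=> t t0.
have [j jM ct] : exists2 j, (j <= M)%N & cell M ts j t.
  have : forall k, (k <= M)%N -> exists2 j, (j <= k)%N &
      ts j <= t /\ ((j < k)%N -> t < ts j.+1).
    elim=> [_|k IH kM]; first by exists 0%N; rewrite ?ts0.
    have [kt|tk] := leP (ts k.+1) t; first by exists k.+1; rewrite ?ltnn.
    have [j jk [jt tj]] := IH (ltnW kM).
    exists j; first exact: leqW.
    by split=> //; rewrite ltnS leq_eqVlt => /predU1P[->//|/tj].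
  by move=> /(_ M (leqnn _)).
exact: Qcell jM _ ct.
Qed.

Lemma running_average_final a b N M (ts : nat -> R) (S0 : 'M[R]_(a, b)) g S t :
  (0 < M)%N -> running_average N M ts S0 g S -> ts M <= t -> S t = S (ts M).
Proof.
move=> M1 [h0 h] Mt; have cM s : ts M <= s -> cell M ts M s.
  by move=> Ms; split=> //; rewrite ltnn.
have MM : (1 <= M <= M)%N by rewrite M1 leqnn.
by rewrite (h M MM t (cM _ Mt)) (h M MM _ (cM _ (lexx _))).
Qed.
End RunningAverage.

(** * Convergence of the gains *)

Theorem corollary1 (R : realType) (n m p N M : nat)
  (* plant and reference model *)
  (As : 'M[R]_n) (Bs : 'M[R]_(n, m)) (Am : 'M[R]_n) (Bm : 'M[R]_(n, p))
  (hpm : (p <= m)%N) (hAm : hurwitz Am) (hAB : controllable Am Bm)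
  (rho : R) (hrho : 0 < rho)
  (* offline experiment *)
  (T : R) (u_off : R -> 'cV[R]_m) (x_off : R -> 'cV[R]_n)
  (hd : trajectory As Bs `[0, T] u_off x_off)
  (uf_off : R -> 'cV[R]_m) (xf_off : R -> 'cV[R]_n)
  (hudf : filtered rho `[0, T] u_off uf_off) (hxdf : filtered rho `[0, T] x_off xf_off)
  (tau : 'I_N -> R) (hN : (1 <= N)%N)
  (htau : forall i j : 'I_N, (i < j)%N -> tau i < tau j)
  (htauT : forall i : 'I_N, 0 < tau i <= T)
  (U : 'M[R]_(m, N)) (X XD : 'M[R]_(n, N))
  (hU : U = sample_mx uf_off tau) (hX : X = sample_mx xf_off tau)
  (hXD : XD = sample_mx (dfiltered rho x_off xf_off) tau)
  (* online closed loop *)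
  (r : R -> 'cV[R]_p) (xm : R -> 'cV[R]_n)
  (hm : trajectory Am Bm `[0, +oo[ r xm)
  (u : R -> 'cV[R]_m) (x : R -> 'cV[R]_n)
  (hx : trajectory As Bs `[0, +oo[ u x)
  (uf : R -> 'cV[R]_m) (xf : R -> 'cV[R]_n)
  (huf : filtered rho `[0, +oo[ u uf) (hxf : filtered rho `[0, +oo[ x xf)
  (hM : (1 <= M)%N) (ts : nat -> R) (hts0 : ts 0%N = 0)
  (hts : forall j, (j < M)%N -> ts j < ts j.+1)
  (Us : R -> 'M[R]_(m, n + n)) (Ds : R -> 'M[R]_(n + n))
  (hUs : running_average N M ts
           (N%:R^-1 *: (U *m (col_mx X XD)^T))
           (fun t => uf t *m (col_mx (xf t) (dfiltered rho x xf t))^T) Us)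
  (hDs : running_average N M ts
           (N%:R^-1 *: (col_mx X XD *m (col_mx X XD)^T))
           (fun t => col_mx (xf t) (dfiltered rho x xf t)
                     *m (col_mx (xf t) (dfiltered rho x xf t))^T) Ds)
  (Gamma : 'M[R]_(n + n)) (hGamma : sym_posdef Gamma)
  (Psi : R -> 'M[R]_(n + n, n + p))
  (hPsi : ode_solution `[0, +oo[ Psi
            (fun t => - (Gamma *m (Ds t *m Psi t - ref_mx Am Bm))))
  (hu : forall t, 0 <= t -> u t = Us t *m Psi t *m col_mx (x t) (r t))
  (* im R_m is included in im D(t_M) *)
  (him : range (fun v : 'cV[R]_(n + p) => ref_mx Am Bm *m v)
         `<=` range (fun w : 'cV[R]_(n + n) => Ds (ts M) *m w))
  (K : R -> 'M[R]_(m, n)) (L : R -> 'M[R]_(m, p))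
  (hKL : forall t, 0 <= t -> row_mx (K t) (L t) = Us t *m Psi t) :
  row_mx (Am - As - Bs *m K t) (Bm - Bs *m L t) @[t --> +oo] --> (0 : 'M[R]_(n, n + p)).
Proof.
pose H : 'M[R]_(n, n + n) := row_mx (- As) 1%:M.
have Hcol a (v w : 'M[R]_(n, a)) : H *m col_mx v w = w - As *m v.
  by rewrite mul_row_col mulNmx mul1mx addrC.
have sub_itv t : `[0, t] `<=` `[(0 : R), +oo[.
  by move=> s; rewrite /= !in_itv/= => /andP[->].
(* Identification: the averaged data satisfy the plant equation.
   Semidefiniteness of Ds is proved by the same induction. *)
have UD t : 0 <= t -> Bs *m Us t = H *m Ds t /\ psd (Ds t).
  pose Q (S : 'M[R]_(m, n + n)) (S' : 'M[R]_(n + n)) :=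
    Bs *m S = H *m S' /\ psd S'.
  apply: (running_average_ind2 (Q := Q) hUs hDs hts0 hts).
  - split; last by apply: psdZ (psd_gram _); rewrite invr_ge0.
    rewrite -!scalemxAr !mulmxA Hcol hXD (sample_mx_dfiltered hd hudf hxdf htauT).
    by rewrite -hX -hU [_ - _]addrC addKr.
  - move=> s s0; split; last exact: psd_gram.
    rewrite !mulmxA Hcol (dfiltered_linear hx huf hxf s0 (sub_itv s)).
    by rewrite [_ - _]addrC addKr.
  - move=> al be A A' B B' al0 be0 [AA pA] [BB pB]; split.
      by rewrite !mulmxDr -!scalemxAr AA BB.
    by apply: psdD; exact: psdZ.
set D := Ds (ts M) in him.
have tsM_ge0 := sampling_times_ge0 hts0 hts (leqnn M).
have DsE t : ts M <= t -> Ds t = D.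
  by move=> Mt; exact: (running_average_final hM hDs Mt).
have [W RmE] : exists W, ref_mx Am Bm = D *m W.
  have /choice[w hw] : forall k, exists w : 'cV[R]_(n + n),
      D *m w = col k (ref_mx Am Bm).
    move=> k; rewrite colE.
    by have [w _ <-] := him _ (ex_intro2 _ _ (delta_mx k 0) I erefl); exists w.
  exists (\matrix_(i, k) w k i 0); apply/matrixP => i k.
  have /(congr1 (fun v : 'cV[R]_(n + n) => v i 0)) := hw k.
  rewrite !mxE => <-; apply: eq_bigr => j _; by rewrite [in RHS]mxE.
(* continuity of Psi makes the right-hand side of its equation continuous past
   the last sampling time, where Psi is therefore differentiable *)
have cPsi t j k : 0 < t -> {for t, continuous (fun s => Psi s j k)}.
  move=> t0; have tt1 : t < t + 1 by rewrite ltrDl.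
  have t10 := lt_trans t0 tt1.
  have := ode_solution_continuous (i := j) (k := k) hPsi (ltW t10) (sub_itv _).
  move=> /(continuous_within_itvP _ t10)[+ _ _]; apply.
  by rewrite in_itv/= t0.
have dPsi t : ts M < t -> forall i k, is_derive t 1 (fun s => Psi s i k)
    ((- (Gamma *m (D *m Psi t - D *m W))) i k).
  move=> Mt i k; have t0 := le_lt_trans tsM_ge0 Mt.
  rewrite -RmE -(DsE t (ltW Mt)).
  apply: (ode_solution_is_derive (t := t + 1) hPsi (sub_itv _)).
    by rewrite t0/= ltrDl.
  have : (- Gamma *m (D *m Psi s - ref_mx Am Bm)) i k @[s --> t] -->
      (- Gamma *m (D *m Psi t - ref_mx Am Bm)) i k.
    apply: cvg_mulmx_entry => j l.
    under eq_fun do rewrite mxE; rewrite mxE.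
    apply: cvgD; last exact: cvg_cst.
    by apply: cvg_mulmx_entry => j' l'; exact: cPsi.
  rewrite /prop_for/continuous_at (DsE t (ltW Mt)) mulNmx; apply: cvg_trans.
  apply: near_eq_cvg; near=> s; rewrite mulNmx DsE//.
  by apply/ltW; near: s; exact: lt_nbhsr.
have res0 := gradient_flow_residual_cvg0 hGamma (UD _ tsM_ge0).2 dPsi.
apply: cvg_mx => i k.
have : (- H *m (D *m Psi t - D *m W)) i k @[t --> +oo] -->
    ((- H) *m (0 : 'M[R]_(n + n, n + p))) i k.
  by apply: cvg_mulmx_entry => j l; rewrite mxE; exact: res0.
(* it remains to see that the matching error is - H times the residual *)
rewrite mulmx0; apply: cvg_trans; apply: near_eq_cvg; near=> t.
have Mt : ts M <= t by near: t; apply: nbhs_pinfty_ge; exact: num_real.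
have t0 := le_trans tsM_ge0 Mt.
congr (fun_of_matrix _ i k).
rewrite -RmE -(DsE t Mt) mulNmx mulmxBr opprB mulmxA -(UD t t0).1 -mulmxA -hKL//.
rewrite /ref_mx mul_row_block mulmx1 mulmx0 !mul1mx add0r mul_mx_row.
by rewrite opp_row_mx add_row_mx [- As + _]addrC.
Unshelve. all: by end_near. Qed.
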